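(* Let $a,b,c,d$ be integers and let $k$ be a nonzero integer such that $3\nmid v_2(k)$ and such that $a$ and $bc+d$ are odd. Suppose that the polynomial $aX^3+bX^2+cX+d$ is irreducible over $\mathbb{Q}$ and that its discriminant is a perfect square. Then the only integer solution $(x,y,z)\in\mathbb{Z}^3$ of the homogeneous equation \[ ax^3+bx^2y+cxy^2+dy^3=kz^3\] is $(x,y,z)=(0,0,0)$.
   Context: For a nonzero integer $k$, $v_2(k)$ denotes the $2$-adic valuation of $k$, i.e. the exponent of the largest power of $2$ dividing $k$. *)

(* Defs.v *)
From HB Require Import structures.
From mathcomp Require Import all_boot all_order all_algebra.
From mathcomp Require Import ring.

Set Implicit Arguments.
Unset Strict Implicit.
Unset Printing Implicit Defensive.

Import GRing.Theory.
Local Open Scope ring_scope.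

Definition cubic (R : comNzRingType) (a b c d : R) : {poly R} :=
  a *: 'X^3 + b *: 'X^2 + c *: 'X + d%:P.

(* Discriminant as a polynomial in the coefficients; [cubic_disc_roots] relates
   it to the roots. Meaningful for [cubic a b c d] only when [a != 0]. *)
Definition cubic_disc (R : comNzRingType) (a b c d : R) : R :=
  b ^+ 2 * c ^+ 2 - 4%:R * a * c ^+ 3 - 4%:R * b ^+ 3 * d
  - 27%:R * a ^+ 2 * d ^+ 2 + 18%:R * a * b * c * d.

Lemma cubic_disc_roots (R : comNzRingType) (a b c d r s t : R) :
  cubic a b c d = a *: (('X - r%:P) * ('X - s%:P) * ('X - t%:P)) ->
  cubic_disc a b c d = a ^+ 4 * ((r - s) * (r - t) * (s - t)) ^+ 2.
Proof.
have -> : a *: (('X - r%:P) * ('X - s%:P) * ('X - t%:P)) =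
  cubic a (- (a * (r + s + t))) (a * (r * s + r * t + s * t))
    (- (a * (r * s * t))).
  by rewrite /cubic -!mul_polyC; ring.
move=> E.
have co (a' b' c' d' : R) : [/\ (cubic a' b' c' d')`_2 = b',
    (cubic a' b' c' d')`_1 = c' & (cubic a' b' c' d')`_0 = d'].
  by rewrite /cubic !coefE /=; split; ring.
have [b1 c1 d1] := co a b c d.
rewrite E in b1 c1 d1.
have [b2 c2 d2] := co a (- (a * (r + s + t))) (a * (r * s + r * t + s * t))
    (- (a * (r * s * t))).
by rewrite -b1 -c1 -d1 b2 c2 d2 /cubic_disc; ring.
Qed.

(* Main.v *)
Require Import Defs.
From HB Require Import structures.
From mathcomp Require Import all_boot all_order all_algebra.
From mathcomp Require Import zify ring.

(** The discriminant is congruent to (bc + ad)^2 mod 2, hence odd. As an odd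
    square is 1 mod 8, Stickelberger's parity rule leaves 1 or 3 irreducible
    factors mod 2; three distinct roots do not fit in F_2 (and a is odd), so the
    form is irreducible, hence anisotropic, mod 2. Thus the 2-adic valuation of
    its value at (x, y) <> (0, 0) is a multiple of 3, whereas that of k z^3 is
    not. *)

Set Implicit Arguments.
Unset Strict Implicit.
Unset Printing Implicit Defensive.

Import GRing.Theory.
Local Open Scope ring_scope.

Lemma odd_abszD (x y : int) : odd `|(x + y)%R|%N = odd `|x|%N (+) odd `|y|%N.
Proof. lia. Qed.

Lemma even_abszP (x : int) : reflect (exists q, x = 2 * q) (~~ odd `|x|%N).
Proof.
apply: (iffP idP) => [xe|[q ->]]; last by lia.
by exists (x %/ 2)%Z; lia.
Qed.

Lemma odd_abszP (x : int) : reflect (exists q, x = 2 * q + 1) (odd `|x|%N).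
Proof.
apply: (iffP idP) => [xo|[q ->]]; last by lia.
by exists (x %/ 2)%Z; lia.
Qed.

Lemma odd_sqr_mod8 (x : int) : odd `|x|%N -> exists q, x ^+ 2 = 8 * q + 1.
Proof.
move=> /odd_abszP[q ->].
have /even_abszP[r hr] : ~~ odd `|(q * (q + 1))%R|%N.
  by rewrite abszM oddM odd_abszD; case: odd.
exists r; have -> : (2 * q + 1) ^+ 2 = 4 * (q * (q + 1)) + 1 by ring.
by rewrite hr; ring.
Qed.

(** Odd squares are 1 mod 8 and even ones 0 or 4. The class 5 is the one that Stickelberger's rule
    attaches to two irreducible factors mod 2. *)
Lemma sqr_neq5_mod8 (m q : int) : m ^+ 2 <> 8 * q + 5.
Proof.
case: (boolP (odd `|m|%N)) => [/odd_sqr_mod8[r ->]|/even_abszP[r ->]]; first lia.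
by rewrite exprMn; lia.
Qed.

(** Given the parity of [a] and [b * c + d], the other reductions mod 2 are X^3 + 1 and X^3 + X^2 +
    X. Both are a linear factor times X^2 + X + 1, and both make the discriminant 5 mod 8. *)
Lemma odd_cubic_coefs (a b c d m : int) :
  odd `|a|%N -> odd `|(b * c + d)%R|%N -> cubic_disc a b c d = m ^+ 2 ->
  odd `|d|%N /\ odd `|b|%N != odd `|c|%N.
Proof.
move=> ao; rewrite odd_abszD abszM oddM /cubic_disc => hbcd hm.
case: (boolP (odd `|d|%N)) hbcd => [dodd|/even_abszP[D dE]];
  rewrite ?addbT ?addbF => hbc.
- split=> //; case: (boolP (odd `|b|%N)) hbc => [|/even_abszP[B bE] _].
    by move=> _ /= /negbTE ->.
  case: (boolP (odd `|c|%N)) => // /even_abszP[C cE]; exfalso.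
  have [s hs] : exists s, (a * d) ^+ 2 = 8 * s + 1.
    by apply: odd_sqr_mod8; rewrite abszM oddM ao.
  (* With [b] and [c] even, only -27 (ad)^2 survives mod 8, and -27 = 8 (-4) + 5. *)
  apply: (@sqr_neq5_mod8 m (2 * B ^+ 2 * C ^+ 2 - 4 * a * C ^+ 3
    - 4 * B ^+ 3 * d - 27 * s - 4 + 9 * a * B * C * d)).
  have -> : m ^+ 2 = 16 * B ^+ 2 * C ^+ 2 - 32 * a * C ^+ 3
      - 32 * B ^+ 3 * d - 27 * (a * d) ^+ 2 + 72 * a * B * C * d.
    by rewrite -hm bE cE; ring.
  by rewrite hs; ring.
- exfalso; case/andP: hbc => bo co.
  have [s hs] : exists s, (b * c) ^+ 2 = 8 * s + 1.
    by apply: odd_sqr_mod8; rewrite abszM oddM bo.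
  have /odd_abszP[w hw] : odd `|(a * c ^+ 3)%R|%N by rewrite abszM abszX oddM oddX ao co.
  (* As [b * c] is odd, the factors [a * D] and [b * c - 3 * (a * D)] have opposite parity. *)
  have /even_abszP[v hv] : ~~ odd `|(a * D * (b * c - 3 * (a * D)))%R|%N.
    move: (a * D) => p.
    by rewrite abszM oddM odd_abszD abszN !abszM !oddM bo co /=; case: odd.
  (* The residue comes from (bc)^2 - 4ac^3, which is 1 - 4 = 8 (-1) + 5 mod 8. *)
  apply: (@sqr_neq5_mod8 m (s - w - 1 - b ^+ 3 * D + 9 * v)).
  have -> : m ^+ 2 = (b * c) ^+ 2 - 4 * (a * c ^+ 3) - 8 * b ^+ 3 * D
      + 36 * (a * D * (b * c - 3 * (a * D))).
    by rewrite -hm dE; ring.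
  by rewrite hs hw hv; ring.
Qed.

Definition cubic_form (R : comNzRingType) (a b c d x y : R) : R :=
  a * x ^+ 3 + b * x ^+ 2 * y + c * x * y ^+ 2 + d * y ^+ 3.

(** Powers do not change parity, so mod 2 the form is x + (b + c)xy + y = x + xy + y, the Boolean
    disjunction. *)
Lemma odd_cubic_form (a b c d x y : int) :
  odd `|a|%N -> odd `|d|%N -> odd `|b|%N != odd `|c|%N ->
  odd `|cubic_form a b c d x y|%N = odd `|x|%N || odd `|y|%N.
Proof.
move=> ao dodd; rewrite /cubic_form !odd_abszD !(abszX, abszM) !(oddX, oddM) ao dodd.
by case: (odd `|b|%N); case: (odd `|c|%N); case: (odd `|x|%N); case: (odd `|y|%N).
Qed.

(** Descent on |x| + |y|: halving two even arguments divides the value by 2^3, until one argument is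
    odd and so is the value. Nonvanishing is stated separately because [logn 2 0 = 0] is divisible
    by 3. *)
Lemma logn2_cubic_form (a b c d x y : int) :
  odd `|a|%N -> odd `|d|%N -> odd `|b|%N != odd `|c|%N -> (x, y) != (0, 0) ->
  cubic_form a b c d x y != 0 /\
  (3 %| logn 2 `|cubic_form a b c d x y|)%N.
Proof.
move=> ao dodd bc.
have [n] := ubnP (`|x| + `|y|)%N; elim: n => // n IHn in x y * => xyn xy0.
case: (boolP (odd `|x|%N || odd `|y|%N)) => [|xy_even].
  rewrite -(odd_cubic_form x y ao dodd bc) => Fo.
  by split; [case: eqP Fo => // -> | rewrite lognE dvdn2 Fo andbF].
move: xy_even xyn xy0; rewrite negb_or => /andP[/even_abszP[u ->] /even_abszP[v ->]].
move=> uvn uv0.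
have {}uv0 : (u, v) != (0, 0) by apply: contra uv0 => /eqP[-> ->].
have uv_pos : (0 < `|u| + `|v|)%N.
  by rewrite lt0n addn_eq0 !absz_eq0; move: uv0; rewrite xpair_eqE.
have [] := IHn u v _ uv0; first by lia.
have -> : cubic_form a b c d (2 * u) (2 * v) = 2 ^+ 3 * cubic_form a b c d u v.
  by rewrite /cubic_form; ring.
move=> F0 dvF; split; first by rewrite mulf_neq0.
by rewrite abszM lognM ?absz_gt0 // dvdn_add.
Qed.

Theorem corollary2 (a b c d k : int)
    (hk : k != 0)
    (hv : ~~ (3 %| logn 2 `|k|%N)%N)
    (ha : odd `|a|%N)
    (hbcd : odd `|(b * c + d)%R|%N)
    (hirr : irreducible_poly (cubic a%:~R b%:~R c%:~R d%:~R : {poly rat}))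
    (hdisc : exists m : int, cubic_disc a b c d = m ^+ 2) :
  forall x y z : int,
    a * x ^+ 3 + b * x ^+ 2 * y + c * x * y ^+ 2 + d * y ^+ 3 = k * z ^+ 3 <->
    (x, y, z) = (0, 0, 0).
Proof.
move=> x y z; split=> [|[-> -> ->]]; last by ring.
rewrite -/(cubic_form a b c d x y) => E.
have [m /(odd_cubic_coefs ha hbcd)[dodd bc]] := hdisc.
have [xy0|/(logn2_cubic_form ha dodd bc)] := eqVneq (x, y) (0, 0).
  move: xy0 E => [-> ->]; rewrite /cubic_form !expr0n /= !mulr0 !addr0.
  by move=> /esym/eqP; rewrite mulf_eq0 (negPf hk) expf_eq0 /= => /eqP ->.
(* A nonzero value forces [z] to be nonzero, so the valuation of the right side is v_2(k) + 3
   v_2(z). *)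
rewrite E mulf_eq0 (negPf hk) expf_eq0 /= => -[z0].
by rewrite abszM abszX lognM ?expn_gt0 ?absz_gt0 ?z0 ?hk // lognX dvdn_addl
  ?dvdn_mulr // (negPf hv).
Qed.
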